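(* Assume that $$\eta:=\inf\left\{\alpha>1;\ \exists c_\alpha>0,\ \int_0^yb(x,y)\,dx\le c_\alpha(1+y)^\alpha\ \ \forall y>0\right\}<+\infty.$$ Then $$\limsup_{y\to+\infty}\frac{\int_0^y(1+x)^\alpha b(x,y)\,dx}{(1+y)^\alpha}\le\limsup_{y\to+\infty}\frac{\int_0^yx^\alpha b(x,y)\,dx}{y^\alpha}\qquad(\forall\alpha>\eta).$$ In particular, if $\eta<+\infty$ and $a$ is unbounded only at infinity, then $\widetilde\alpha\le\eta$, provided $\widetilde\alpha$ is finite, where $$\widetilde\alpha:=\inf\left\{\alpha>1;\ \limsup_{a(y)\to+\infty}\frac{n_{1,\alpha}(y)}{(1+y)^\alpha}<1\right\},\qquad n_{1,\alpha}(y):=\int_0^y(1+x)^\alpha b(x,y)\,dx.$$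
   Context: The total fragmentation rate $a\in L^1_{loc}(0,+\infty)$ is nonnegative. The fragmentation kernel $b(\cdot,\cdot)\ge 0$ is measurable, $b(x,y)=0$ if $x\ge y$, and $\int_0^y x\,b(x,y)\,dx=y$ for $y>0$. ''$a$ is unbounded only at infinity'' means that $a$ is unbounded on $(0,+\infty)$ but bounded on $(0,R)$ for every $R>0$. $\limsup_{a(y)\to+\infty}g(y):=\lim_{c\to+\infty}\sup_{\{y:\,a(y)\ge c\}}g(y)$. The infimum of the empty set is $+\infty$. *)

(* Defs.v *)
From HB Require Import structures.
From mathcomp Require Import all_boot all_order all_algebra.
From mathcomp Require Import all_classical all_reals all_analysis.
Set Implicit Arguments.
Unset Strict Implicit.
Unset Printing Implicit Defensive.
Import Order.TTheory GRing.Theory Num.Theory.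
Import numFieldNormedType.Exports.
Local Open Scope classical_set_scope.
Local Open Scope ring_scope.

Section fragmentation.
Context {R : realType}.
Implicit Types (a : R -> R) (b : R -> R -> R) (g : R -> \bar R) (alpha y : R).
Local Notation mu := (@lebesgue_measure R).

Definition fragmentation_rate a : Prop :=
  locally_integrable `]0, +oo[ a /\ (forall y, 0 < y -> 0 <= a y).

(* Only the values of b on ]0, +oo[ x ]0, +oo[ are constrained. *)
Definition fragmentation_kernel b : Prop :=
  [/\ measurable_fun ((`]0, +oo[ : set R) `*` (`]0, +oo[ : set R))
        (fun z : R * R => b z.1 z.2),
      forall x y, 0 < x -> 0 < y -> 0 <= b x y,
      forall x y, 0 < y -> y <= x -> b x y = 0 &
      forall y, 0 < y -> (\int[mu]_(x in `]0%R, y[) (x * b x y)%:E = y%:E)%E].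

Definition unbounded_only_at_infinity a : Prop :=
  ~ [bounded a y | y in (`]0, +oo[ : set R)] /\
  (forall r : R, 0 < r -> [bounded a y | y in (`]0, r[ : set R)]).

Definition limsup_pinfty g : \bar R := limf_esup g (pinfty_nbhs R).

(* The limit exists in \bar R since the supremum is nonincreasing in c; it is
   taken over an empty set, hence equal to -oo, once c exceeds every value of
   a on ]0, +oo[. *)
Definition limsup_rate a g : \bar R :=
  lim (ereal_sup (g @` [set y | 0 < y /\ c <= a y]) @[c --> +oo]).

Definition moment b alpha y : \bar R :=
  \int[mu]_(x in `]0, y[) (x `^ alpha * b x y)%:E.

Definition shifted_moment b alpha y : \bar R :=
  \int[mu]_(x in `]0, y[) ((1 + x) `^ alpha * b x y)%:E.

Definition eta b : \bar R :=
  ereal_inf (EFin @` [set alpha | 1 < alpha /\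
    exists2 c : R, 0 < c & forall y, 0 < y ->
      (\int[mu]_(x in `]0%R, y[) (b x y)%:E <= (c * (1 + y) `^ alpha)%:E)%E]).

Definition alpha_tilde a b : \bar R :=
  ereal_inf (EFin @` [set alpha | 1 < alpha /\
    (limsup_rate a
       (fun y => shifted_moment b alpha y / ((1 + y) `^ alpha)%:E) < 1)%E]).

End fragmentation.

(* Main.v *)
Require Import Defs.
From mathcomp Require Import all_boot all_order all_algebra.
From mathcomp Require Import all_classical all_reals all_analysis.
From mathcomp Require Import measurable_realfun lra ring.
Import Order.TTheory GRing.Theory Num.Theory.
Import numFieldNormedType.Exports.
Local Open Scope classical_set_scope.
Local Open Scope ring_scope.
Local Open Scope ereal_scope.

(** Everything rests on the measure [x * b x y] on [0 < x < y], of total mass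
    [y].

    For the comparison of the upper limits, [(1 + x) `^ alpha] is at most
    [(1 + e) * x `^ alpha + C] for every [e > 0].  Integrating against [b]
    bounds the shifted moment by [1 + e] times the moment, plus [C] times the
    number of fragments.  If [alpha > eta b], the latter is [O((1 + y) `^ alpha')]
    for some [alpha' < alpha] and disappears after division by
    [(1 + y) `^ alpha].  Since the moment is at most [y `^ alpha], the factor
    [1 + e] costs only an additive [e].  This gives [shifted_ratio_le]: the
    shifted ratio exceeds the plain one by an arbitrarily small amount once
    [y] is large.

    For the bound on [alpha_tilde], finiteness provides one exponent [alpha0]
    whose shifted ratio stays below some [r < 1] where [a] is large.  Such
    points [y] are themselves large, because [a] is bounded on bounded
    intervals, so the plain ratio of exponent [alpha0] is below some
    [rho < 1] there.  This strict gap passes to any other exponent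
    [alpha > 1]: writing [s = x / y], the function [s `^ (alpha - 1)] lies below
    [1 - t + t * s `^ (alpha0 - 1)] for some [0 < t <= 1], and integration against
    the measure of mass [y] bounds the plain ratio of exponent [alpha] by
    [1 - t + t * rho < 1] ([moment_le_chord]).  If moreover [alpha > eta b],
    [shifted_ratio_le] returns to the shifted ratio, so [alpha] is admissible
    in the definition of [alpha_tilde].

    The whole second argument runs over the points where [a] is large, and
    not over all large [y]: [a] may be unbounded without tending to
    infinity. *)

(** * Inequalities between real powers *)

Section real_powers.
Context {R : realType}.
Local Open Scope ring_scope.
Implicit Types (x y s : R).

Lemma lee_pdivr (x : \bar R) (r s : R) : 0 < r ->
  (x / r%:E <= s%:E)%E = (x <= (s * r)%:E)%E.
Proof. by move=> r0; rewrite inver gt_eqF// lee_pdivrMr. Qed.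

(** Convexity of the exponential between [ln s] and [0]. *)
Lemma powR_le_chord s (t : R) : 0 < s -> 0 <= t <= 1 ->
  s `^ t <= 1 - t + t * s.
Proof.
move=> s0 /andP[t0 t1].
have := convex_expR (Itv01 t0 t1) (ln s) 0.
rewrite !convRE /= expR0 lnK ?posrE// mulr0 addr0 mulr1.
by rewrite /powR gt_eqF// addrC.
Qed.

(** On [0 < s <= 1] the power can only grow when [beta] is replaced by
    [t * gamma <= beta]; the chord bound then applies to [s `^ gamma]. *)
Lemma powR_le_powR_chord (beta gamma : R) : 0 < beta -> 0 < gamma ->
  exists2 t : R, 0 < t <= 1 &
    forall s, 0 < s <= 1 -> s `^ beta <= 1 - t + t * s `^ gamma.
Proof.
move=> beta0 gamma0; pose t : R := Num.min 1 (beta / gamma).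
have t0 : 0 < t by rewrite lt_min ltr01 divr_gt0.
have t1 : t <= 1 by rewrite ge_min lexx.
exists t => [|s s01]; first by rewrite t0.
have s0 : 0 < s by case/andP: s01.
have t01 : 0 <= t <= 1 by rewrite ltW.
apply: le_trans (powR_le_chord _ _ (powR_gt0 gamma s0) t01).
rewrite -powRrM; apply: ger_powR => //.
by rewrite mulrC -ler_pdivlMr// ge_min lexx orbT.
Qed.

(** With [k := (1 + e) `^ alpha^-1 > 1], the inequality [1 + x <= k * x] holds
    as soon as [x >= (k - 1)^-1]. *)
Lemma near_powR_shift_le (alpha e : R) : 0 < alpha -> 0 < e ->
  exists2 M : R, 0 < M &
    forall x, M <= x -> (1 + x) `^ alpha <= (1 + e) * x `^ alpha.
Proof.
move=> alpha0 e0; pose k := (1 + e) `^ alpha^-1.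
have kE : k `^ alpha = 1 + e.
  by rewrite -powRrM mulVf ?gt_eqF// powRr1//; lra.
have k1 : 1 < k.
  have -> : 1 = 1 `^ alpha^-1 by rewrite powR1.
  by apply: gt0_ltr_powR; rewrite ?invr_gt0 ?nnegrE//; lra.
exists (k - 1)^-1 => [|x Mx]; first by rewrite invr_gt0; lra.
have x0 : 0 < x by apply: lt_le_trans Mx; rewrite invr_gt0; lra.
rewrite -kE -powRM; [|lra|lra].
apply: ge0_ler_powR; rewrite ?nnegrE; [lra|lra|nra|].
have : 1 <= x * (k - 1) by rewrite -ler_pdivrMr ?div1r//; lra.
lra.
Qed.

(** The constant absorbs the bounded range of [x] where the multiplicative
    bound may fail. *)
Lemma powR_shift_le_affine (alpha e : R) : 0 < alpha -> 0 < e ->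
  exists2 C : R, 0 <= C &
    forall x, 0 < x -> (1 + x) `^ alpha <= (1 + e) * x `^ alpha + C.
Proof.
move=> alpha0 e0; have [M M0 HM] := near_powR_shift_le alpha e alpha0 e0.
exists ((1 + M) `^ alpha) => [|x x0]; first exact: powR_ge0.
have [Mx|xM] := leP M x.
  by rewrite (le_trans (HM x Mx))// lerDl powR_ge0.
apply: (@le_trans _ _ ((1 + M) `^ alpha)); last first.
  by rewrite lerDr mulr_ge0 ?powR_ge0//; lra.
by apply: ge0_ler_powR; rewrite ?nnegrE; lra.
Qed.

Lemma powR_absorb_le (alpha' alpha K e : R) : alpha' < alpha -> 0 < e ->
  exists2 Y : R, 0 < Y &
    forall y, Y <= y -> K * (1 + y) `^ alpha' <= e * (1 + y) `^ alpha.
Proof.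
move=> lt_alpha e0; pose d := alpha - alpha'.
have d0 : 0 < d by rewrite /d subr_gt0.
pose m : R := Num.max 1 (K / e).
have m0 : 0 < m by rewrite lt_max ltr01.
have Km : K / e <= m by rewrite le_max lexx orbT.
pose Y := m `^ d^-1.
exists Y => [|y Yy]; first exact: powR_gt0.
have Y0 : 0 < Y by exact: powR_gt0.
have -> : alpha = d + alpha' by rewrite /d subrK.
have y1 : 1 + y != 0 by rewrite gt_eqF//; lra.
rewrite powRD ?y1 ?implybT// mulrA ler_wpM2r ?powR_ge0//.
rewrite mulrC -ler_pdivrMr//.
apply: (@le_trans _ _ (Y `^ d)).
  by rewrite /Y -powRrM mulVf ?gt_eqF// powRr1 ?(ltW m0).
by apply: ge0_ler_powR; rewrite ?nnegrE; lra.
Qed.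
End real_powers.

(** * Moments of the fragmentation kernel *)

Lemma measurable_powR_shift {R : realType} (alpha : R) :
  measurable_fun [set: R] (fun x : R => ((1 + x) `^ alpha)%R).
Proof.
apply: (@measurableT_comp _ _ _ _ _ _ (@powR R ^~ alpha) _ (fun x : R => 1 + x)%R).
  exact: measurable_powR.
exact: measurable_funD.
Qed.

Section kernel.
Context {R : realType} (b : R -> R -> R).
Hypothesis hb : fragmentation_kernel b.
Local Notation mu := (@lebesgue_measure R).
Local Open Scope ring_scope.

Lemma measurable_kernel_section (y : R) : 0 < y -> measurable_fun (`]0, y[%classic : set R) (b ^~ y).
Proof.
move=> y0; case: hb => mb _ _ _.
apply: (@measurable_comp _ _ _ _ _ _ ((`]0, +oo[%classic : set R) `*` (`]0, +oo[%classic : set R))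
  (fun z : R * R => b z.1 z.2) _ (fun x => (x, y))) => //.
- exact: measurableX.
- move=> _ [x /= + <-]; rewrite !in_itv/= => /andP[-> _].
  by rewrite y0.
- by apply: measurable_funTS; exact: measurable_fun_pair.
Qed.

Lemma ge0_kernel (x y : R) : 0 < y -> (`]0, y[%classic : set R) x -> 0 <= b x y.
Proof.
by move=> y0 /=; rewrite in_itv/= => /andP[x0 _]; case: hb => _ + _ _; apply.
Qed.

(** All comparisons of moments are instances of this one, with [f], [g], [h]
    power weights; a two-term bound takes [h = 0]. *)
Lemma kernel_integral_le (f g h : R -> R) (p q y : R) : 0 < y ->
  measurable_fun setT f -> measurable_fun setT g -> measurable_fun setT h ->
  0 <= p -> 0 <= q ->
  (forall x, 0 < x < y -> [/\ 0 <= f x, 0 <= g x, 0 <= h x &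
                            f x <= p * g x + q * h x]) ->
  (\int[mu]_(x in `]0%R, y[) (f x * b x y)%:E <=
   p%:E * \int[mu]_(x in `]0%R, y[) (g x * b x y)%:E +
   q%:E * \int[mu]_(x in `]0%R, y[) (h x * b x y)%:E)%E.
Proof.
move=> y0 mf mg mh p0 q0 H.
have Hin x : (`]0, y[%classic : set R) x -> 0 < x < y by rewrite /= in_itv.
have mM (w : R -> R) : measurable_fun setT w ->
    measurable_fun (`]0, y[%classic : set R) (fun x => (w x * b x y)%:E).
  move=> mw; apply/measurable_EFinP; apply: measurable_funM.
    exact: measurable_funTS.
  exact: measurable_kernel_section.
have b0 x : (`]0, y[%classic : set R) x -> 0 <= b x y by exact: ge0_kernel.
have g0 x : (`]0, y[%classic : set R) x -> (0 <= (g x * b x y)%:E)%E.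
  by move=> xy; rewrite lee_fin mulr_ge0 ?b0//; case: (H x (Hin x xy)).
have h0 x : (`]0, y[%classic : set R) x -> (0 <= (h x * b x y)%:E)%E.
  by move=> xy; rewrite lee_fin mulr_ge0 ?b0//; case: (H x (Hin x xy)).
rewrite -ge0_integralZl_EFin//; last exact: mM.
rewrite -ge0_integralZl_EFin//; last exact: mM.
have mp (w : R -> R) (r : R) : measurable_fun setT w ->
    measurable_fun (`]0, y[%classic : set R) (fun x => r%:E * (w x * b x y)%:E)%E.
  by move=> mw; apply: measurable_funeM; exact: mM.
rewrite -ge0_integralD//; first last.
- exact: mp.
- by move=> x xy; apply: mule_ge0; [rewrite lee_fin|exact: h0].
- exact: mp.
- by move=> x xy; apply: mule_ge0; [rewrite lee_fin|exact: g0].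
apply: ge0_le_integral => //.
- by move=> x xy; rewrite lee_fin mulr_ge0 ?b0//; case: (H x (Hin x xy)).
- exact: mM.
- by apply: emeasurable_funD; exact: mp.
- move=> x xy; case: (H x (Hin x xy)) => _ _ _ fle.
  rewrite -!EFinM -EFinD lee_fin !mulrA -mulrDl.
  by rewrite ler_wpM2r ?b0.
Qed.

(** Mass conservation, since [x `^ alpha <= y `^ (alpha - 1) * x] for [x < y]. *)
Lemma moment_le_powR (alpha y : R) : 1 < alpha -> 0 < y ->
  (moment b alpha y <= (y `^ alpha)%:E)%E.
Proof.
move=> alpha1 y0.
have H := @kernel_integral_le (@powR R ^~ alpha) id (cst 0) (y `^ (alpha - 1)) 0 y.
apply: le_trans (H _ _ _ _ _ _ _) _ => //.
- exact: powR_ge0.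
- move=> x /andP[x0 xy]; rewrite mul0r addr0.
  split; [exact: powR_ge0|exact: ltW|exact: lexx|].
  have <- : x * x `^ (alpha - 1) = x `^ alpha by rewrite mulr_powRB1; lra.
  rewrite mulrC ler_wpM2r ?(ltW x0)//.
  by apply: ge0_ler_powR; rewrite ?nnegrE; lra.
- case: hb => _ _ _ ->//.
  by rewrite mul0e adde0 -EFinM mulrC mulr_powRB1 ?(ltW y0)//; lra.
Qed.

Lemma moment_fin (alpha y : R) : 1 < alpha -> 0 < y ->
  exists2 m : R, 0 <= m <= y `^ alpha & moment b alpha y = m%:E.
Proof.
move=> alpha1 y0; have := moment_le_powR alpha y alpha1 y0.
have : (0 <= moment b alpha y)%E.
  apply: integral_ge0 => x xy; rewrite lee_fin mulr_ge0 ?powR_ge0//.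
  exact: ge0_kernel.
case: (moment b alpha y) => // m; rewrite !lee_fin => m0 my.
by exists m; rewrite ?m0.
Qed.

Lemma moment_le_shifted_moment (alpha y : R) : 1 < alpha -> 0 < y ->
  (moment b alpha y <= shifted_moment b alpha y)%E.
Proof.
move=> alpha1 y0.
have H := @kernel_integral_le (@powR R ^~ alpha) (fun x => (1 + x) `^ alpha)
  (cst 0) 1 0 y.
apply: le_trans (H _ _ _ _ _ _ _) _ => //.
- exact: measurable_powR_shift.
- move=> x /andP[x0 xy]; rewrite mul0r addr0 mul1r; split; rewrite ?powR_ge0//.
  by apply: ge0_ler_powR; rewrite ?nnegrE; lra.
- by rewrite mul0e adde0 mul1e.
Qed.

Lemma shifted_moment_le (alpha e : R) : 0 < alpha -> 0 < e ->
  exists2 C : R, 0 <= C & forall y, 0 < y ->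
    (shifted_moment b alpha y <= (1 + e)%:E * moment b alpha y +
       C%:E * \int[mu]_(x in `]0%R, y[) (b x y)%:E)%E.
Proof.
move=> alpha0 e0; have [C C0 HC] := powR_shift_le_affine alpha e alpha0 e0.
exists C => // y y0.
have H := @kernel_integral_le (fun x => (1 + x) `^ alpha) (@powR R ^~ alpha)
  (cst 1) (1 + e) C y.
apply: le_trans (H _ _ _ _ _ _ _) _ => //.
- exact: measurable_powR_shift.
- lra.
- by move=> x /andP[x0 xy]; rewrite mulr1; split; rewrite ?powR_ge0 ?HC.
- by under [X in (_ + C%:E * X <= _)%E]eq_integral do rewrite mul1r.
Qed.

(** The gap in the ratio of exponent [alpha0] is inherited by every other
    exponent: integrate the chord inequality for [s = x / y] against the
    measure [x * b x y], whose mass is [y]. *)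
Lemma moment_le_chord (alpha alpha0 : R) : 1 < alpha -> 1 < alpha0 ->
  exists2 t : R, 0 < t <= 1 & forall y rho, 0 < y ->
    (moment b alpha0 y <= (rho * y `^ alpha0)%:E)%E ->
    (moment b alpha y <= ((1 - t + t * rho) * y `^ alpha)%:E)%E.
Proof.
move=> alpha1 alpha01.
have [||t t01 Ht] := powR_le_powR_chord (alpha - 1) (alpha0 - 1); [lra|lra|].
have /andP[t0 t1] := t01; exists t => // y rho y0 le_rho.
have ya : 0 < y `^ alpha by exact: powR_gt0.
have ya0 : 0 < y `^ alpha0 by exact: powR_gt0.
(* The chord inequality, multiplied by [x / y * y `^ alpha], gives the weight
   [p] in front of [x] and [q] in front of [x `^ alpha0]. *)
pose q := t * (y `^ alpha / y `^ alpha0).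
pose p := (1 - t) * (y `^ alpha / y).
have q0 : 0 <= q by rewrite /q !(mulr_ge0, invr_ge0) ?(ltW t0) ?(ltW ya) ?(ltW ya0).
have p0 : 0 <= p by rewrite /p !(mulr_ge0, invr_ge0) ?subr_ge0 ?(ltW ya) ?(ltW y0).
have H := @kernel_integral_le (@powR R ^~ alpha) id (@powR R ^~ alpha0) p q y.
apply: le_trans (H _ _ _ _ _ _ _) _ => //.
- move=> x /andP[x0 xy].
  split; [exact: powR_ge0|exact: ltW|exact: powR_ge0|].
  have s0 : 0 < x / y by rewrite divr_gt0.
  have := Ht (x / y); rewrite s0 ler_pdivrMr// mul1r (ltW xy) => /(_ isT) Hs.
  have E r : 0 < r -> x `^ r = x / y * (x / y) `^ (r - 1) * y `^ r.
    move=> r0; rewrite mulr_powRB1 ?(ltW s0)// -powRM ?(ltW s0) ?(ltW y0)//.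
    by rewrite divfK// gt_eqF.
  rewrite (E alpha) ?(E alpha0); [|lra|lra].
  apply: (@le_trans _ _ (x / y * (1 - t + t * (x / y) `^ (alpha0 - 1)) * y `^ alpha)).
    by rewrite ler_wpM2r ?(ltW ya)// ler_wpM2l ?(ltW s0).
  rewrite le_eqVlt; apply/orP; left; apply/eqP; rewrite /p /q.
  by field; rewrite !gt_eqF.
- case: hb => _ _ _ ->//.
  apply: (@le_trans _ _ ((p * y)%:E + q%:E * (rho * y `^ alpha0)%:E)%E).
    by rewrite leeD// lee_wpmul2l// lee_fin.
  rewrite -EFinM -EFinD lee_fin le_eqVlt; apply/orP; left; apply/eqP.
  by rewrite /p /q; field; rewrite !gt_eqF.
Qed.

Lemma eta_lt_witness (alpha : R) : (eta b < alpha%:E)%E ->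
  exists alpha' c : R, [/\ 1 < alpha', alpha' < alpha, 0 < c &
    forall y, 0 < y ->
      (\int[mu]_(x in `]0%R, y[) (b x y)%:E <= (c * (1 + y) `^ alpha')%:E)%E].
Proof.
move=> /ereal_inf_lt[_ [alpha' [alpha'1 [c c0 Hc]] <-]]; rewrite lte_fin => lt.
by exists alpha', c.
Qed.

(** The number of fragments grows with an exponent [alpha' < alpha], so its
    contribution to the shifted ratio vanishes at infinity; this is where
    [eta b < alpha] enters. *)
Lemma shifted_ratio_le (alpha e : R) : (eta b < alpha%:E)%E -> 0 < e ->
  exists2 Y : R, 0 < Y & forall y, Y <= y ->
    (shifted_moment b alpha y / ((1 + y) `^ alpha)%:E <=
     moment b alpha y / (y `^ alpha)%:E + e%:E)%E.
Proof.
move=> /eta_lt_witness[alpha' [c [alpha'1 lt_alpha c0 Hc]]] e0.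
have alpha1 : 1 < alpha by exact: lt_trans lt_alpha.
have [||C C0 HC] := shifted_moment_le alpha (e / 2); [lra|lra|].
have [|Y Y0 HY] := powR_absorb_le _ _ (C * c) (e / 2) lt_alpha; first lra.
exists Y => // y Yy; have y0 : 0 < y by exact: lt_le_trans Yy.
have [m /andP[m0 my] mE] := moment_fin alpha y alpha1 y0.
have ya : 0 < y `^ alpha by exact: powR_gt0.
have ya1 : 0 < (1 + y) `^ alpha by apply: powR_gt0; lra.
have yle : y `^ alpha <= (1 + y) `^ alpha.
  by apply: ge0_ler_powR; rewrite ?nnegrE; lra.
rewrite mE [in leRHS]inver (gt_eqF ya) -EFinM -EFinD lee_pdivr//.
apply: le_trans (HC y y0) _; rewrite mE.
apply: (@le_trans _ _ ((1 + e / 2)%:E * m%:E + C%:E * (c * (1 + y) `^ alpha')%:E)%E).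
  by rewrite leeD2l// lee_wpmul2l ?lee_fin// Hc.
rewrite -!EFinM -EFinD lee_fin mulrA.
have := HY y Yy.
have : m <= m / y `^ alpha * (1 + y) `^ alpha.
  by rewrite mulrAC ler_pdivlMr// ler_wpM2l.
have : e / 2 * m <= e / 2 * (1 + y) `^ alpha.
  by rewrite ler_wpM2l//; lra.
lra.
Qed.
End kernel.

(** * Upper limits at infinity and where the rate is large *)

Section limsups.
Context {R : realType}.

Lemma limsup_pinfty_le_eps (f g : R -> \bar R) :
  (forall e : R, (0 < e)%R -> exists2 Y : R, (0 < Y)%R &
     forall y, (Y <= y)%R -> f y <= g y + e%:E) ->
  limsup_pinfty f <= limsup_pinfty g.
Proof.
move=> H; apply/lee_addgt0Pr => e e0.
have [Y _ HY] := H e e0.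
rewrite -leeBlDr//; apply: le_ereal_inf_tmp => _ [A [M [Mr HM]] <-].
rewrite leeBlDr//.
pose N := Num.max M Y.
apply: (@le_trans _ _ (ereal_sup (f @` [set y | (N < y)%R]))).
  apply: ereal_inf_lbound; exists [set y | (N < y)%R] => //.
  by exists N; split => //; exact: num_real.
apply: ge_ereal_sup => _ [y Ny <-].
have [My Yy] : (M < y)%R /\ (Y < y)%R.
  by move: Ny; rewrite /= /N gt_max => /andP[].
apply: le_trans (HY y (ltW Yy)) _.
by rewrite leeD2r//; apply: ereal_sup_ubound; exists y => //; exact: HM.
Qed.

(** The suprema are nonincreasing in the threshold [c]. *)
Lemma limsup_rateE (a : R -> R) (g : R -> \bar R) :
  limsup_rate a g = ereal_inf
    (range (fun c : R => ereal_sup (g @` [set y | (0 < y)%R /\ (c <= a y)%R]))).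
Proof.
apply: cvg_lim => //; apply: nonincreasing_cvge => c c' cc'.
apply: le_ereal_sup; apply: image_subset => y /= [y0 cy]; split => //.
exact: le_trans cy.
Qed.

Lemma limsup_rate_le (a : R -> R) (g : R -> \bar R) (c : R) (r : \bar R) :
  (forall y, (0 < y)%R -> (c <= a y)%R -> g y <= r) -> limsup_rate a g <= r.
Proof.
move=> H; rewrite limsup_rateE.
apply: (@le_trans _ _ (ereal_sup (g @` [set y | (0 < y)%R /\ (c <= a y)%R]))).
  by apply: ereal_inf_lbound; exists c.
by apply: ge_ereal_sup => _ [y [y0 cy] <-]; exact: H.
Qed.

(** The bound [r] can be taken nonnegative, which also covers a supremum
    equal to [-oo]. *)
Lemma limsup_rate_lt1 (a : R -> R) (g : R -> \bar R) : limsup_rate a g < 1 ->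
  exists c r : R, (0 <= r < 1)%R /\
    forall y, (0 < y)%R -> (c <= a y)%R -> g y <= r%:E.
Proof.
rewrite limsup_rateE => /ereal_inf_lt[_ [c _ <-]].
set s := ereal_sup _ => s1.
have [r [r0 sr]] : exists r : R, (0 <= r < 1)%R /\ s <= r%:E.
  case: s s1 => [s s1|//|_]; last by exists 0%R; rewrite lexx ltr01 leNye.
  exists (Num.max 0 s)%R; rewrite !lee_fin le_max lexx le_max lexx orbT gt_max ltr01.
  by split.
exists c, r; split => // y y0 cy; apply: le_trans sr.
by apply: ereal_sup_ubound; exists y.
Qed.

Lemma large_rate_large_size (a : R -> R) (Y : R) :
  unbounded_only_at_infinity a -> (0 < Y)%R ->
  exists c : R, forall y, (0 < y)%R -> (c <= a y)%R -> (Y <= y)%R.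
Proof.
move=> [_ Hb] Y0; have [M [Mr HM]] := Hb Y Y0.
(* [M] itself need not bound [a] on the interval; every [M' > M] does, in
   particular [M + 1]. *)
exists (M + 2)%R => y y0 cy; rewrite leNgt; apply/negP => yY.
have := HM (M + 1)%R; rewrite ltrDl ltr01 => /(_ isT y).
rewrite /= in_itv/= y0 yY => /(_ isT) /(le_trans (ler_norm _)).
lra.
Qed.
End limsups.

(** * Comparison of the upper limits and bound on the critical exponent *)

Theorem proposition5 (R : realType) (a : R -> R) (b : R -> R -> R)
    (ha : fragmentation_rate a) (hb : fragmentation_kernel b)
    (heta : eta b < +oo) :
  (forall alpha : R, eta b < alpha%:E ->
     limsup_pinfty (fun y => shifted_moment b alpha y / ((1 + y) `^ alpha)%:E)
       <= limsup_pinfty (fun y => moment b alpha y / (y `^ alpha)%:E)) /\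
  (unbounded_only_at_infinity a -> alpha_tilde a b \is a fin_num ->
     alpha_tilde a b <= eta b).
Proof.
split=> [alpha lt_eta|ainfty fin_tilde].
  by apply: limsup_pinfty_le_eps => e e0; exact: shifted_ratio_le.
have [_ [alpha0 [alpha01 lim0] _] _] :
    exists2 x, (EFin @` [set alpha | (1 < alpha)%R /\
      limsup_rate a (fun y => shifted_moment b alpha y /
        ((1 + y) `^ alpha)%:E) < 1]) x & x < +oo.
  by apply: ereal_inf_lt; rewrite ltey_eq fin_tilde.
(* Elements [alpha] of the set defining [eta b] satisfy only
   [eta b <= alpha]; the slack [e] makes the inequality strict. *)
suff tilde_le (alpha : R) : eta b < alpha%:E -> alpha_tilde a b <= alpha%:E.
  apply: le_ereal_inf_tmp => _ [alpha Halpha <-].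
  apply/lee_addgt0Pr => e e0; apply: tilde_le.
  apply: (@le_lt_trans _ _ alpha%:E); last by rewrite lte_fin ltrDl.
  by apply: ereal_inf_lbound; exists alpha.
move=> lt_eta; have alpha1 : (1 < alpha)%R.
  have [alpha' [_ [alpha'1 lt_alpha _ _]]] := eta_lt_witness b alpha lt_eta.
  exact: lt_trans lt_alpha.
apply: ereal_inf_lbound; exists alpha; [split; [exact: alpha1|]|reflexivity].
have [c0 [r [/andP[r0 r1] Hr]]] := limsup_rate_lt1 _ _ lim0.
have [t /andP[t0 t1] Ht] := moment_le_chord b hb alpha alpha0 alpha1 alpha01.
(* [rho] leaves room between [r] and [1] for the factor [1 + (1 - r) / 2] lost
   in passing from [(1 + y) `^ alpha0] to [y `^ alpha0]. *)
pose rho : R := ((1 + r) / 2)%R.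
pose sigma : R := (1 - t + t * rho)%R.
have sigma1 : (sigma < 1)%R by rewrite /sigma /rho; nra.
have [||Y1 Y10 HY1] := near_powR_shift_le alpha0 ((1 - r) / 2)%R; [lra|lra|].
have [|Y2 Y20 HY2] := shifted_ratio_le b hb alpha ((1 - sigma) / 2)%R lt_eta.
  lra.
have [c1 Hc1] := large_rate_large_size a Y1 ainfty Y10.
have [c2 Hc2] := large_rate_large_size a Y2 ainfty Y20.
pose c : R := Num.max c0 (Num.max c1 c2).
apply: (@le_lt_trans _ _ ((1 + sigma) / 2)%:E); last first.
  by rewrite lte_fin; lra.
apply: (@limsup_rate_le _ _ _ c) => y y0.
rewrite /c !ge_max => /and3P[c0y c1y c2y].
apply: le_trans (HY2 y (Hc2 y y0 c2y)) _.
have -> : ((1 + sigma) / 2)%:E = sigma%:E + ((1 - sigma) / 2)%:E.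
  by rewrite -EFinD; congr (_%:E); lra.
rewrite leeD2r// lee_pdivr ?powR_gt0//; apply: Ht => //.
apply: le_trans (moment_le_shifted_moment b hb _ _ alpha01 y0) _.
have := Hr y y0 c0y; rewrite lee_pdivr; last by apply: powR_gt0; lra.
move/le_trans; apply; rewrite lee_fin.
have := HY1 y (Hc1 y y0 c1y).
have := powR_ge0 y alpha0; set w := (y `^ alpha0)%R; set z := ((1 + y) `^ alpha0)%R.
move=> w0 zw; rewrite /rho.
apply: (@le_trans _ _ (r * ((1 + (1 - r) / 2) * w))%R); first exact: ler_wpM2l.
rewrite mulrA; apply: ler_wpM2r => //; nra.
Qed.
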